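(* If $H$ is an intersecting $5$-segment hypergraph, then $\tau(H) \le 3$.
   Context: A hypergraph $H=(V,E)$ consists of a vertex set $V$ and an edge set $E \subset 2^V$. For an integer $r \ge 2$, a hypergraph $H=(V,E)$ with $V \subset \mathbb{Z}^2$ is an $r$-segment hypergraph if (i) every edge in $E$ consists of $r$ consecutive integer points (points of $\mathbb{Z}^2$) on some line in $\mathbb{R}^2$, and (ii) every line in $\mathbb{R}^2$ contains at most one edge of $H$. The matching number $\nu(H)$ is the maximum number of pairwise disjoint edges; $H$ is intersecting if $\nu(H)=1$. The covering number $\tau(H)$ is the minimum size of a set of vertices meeting every edge of $H$. *)

(* Defs.v *)
From mathcomp Require Import all_boot all_order all_algebra.
From mathcomp Require Import mathcomp_extra boolp classical_sets functions.
From mathcomp Require Import cardinality reals.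

Set Implicit Arguments.
Unset Strict Implicit.
Unset Printing Implicit Defensive.

Import Order.TTheory GRing.Theory Num.Theory.

Local Open Scope classical_set_scope.
Local Open Scope card_scope.
Local Open Scope ring_scope.

Record hypergraph (T : Type) := Hypergraph {
  vertices : set T;
  edges : set (set T);
  edges_sub : forall e, edges e -> e `<=` vertices }.

Section HypergraphInvariants.
Variables (T : Type) (H : hypergraph T).

Definition matching (M : set (set T)) : Prop :=
  M `<=` edges H /\ trivIset M id.

Definition covering (C : set T) : Prop :=
  C `<=` vertices H /\ (forall e, edges H e -> C `&` e !=set0).

(* Hypergraphs may be infinite, so the invariants are relations
   "nu(H) = n" and "tau(H) = n", comparing cardinalities with that of
   `I_n = {0, ..., n - 1}; the maximum (resp. minimum) ranges over all
   matchings (resp. coverings), infinite ones included. *)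
Definition is_matching_number (n : nat) : Prop :=
  (exists2 M, matching M & M #= `I_n) /\
  (forall M, matching M -> M #<= `I_n).

Definition is_covering_number (n : nat) : Prop :=
  (exists2 C, covering C & C #= `I_n) /\
  (forall C, covering C -> `I_n #<= C).

Definition intersecting : Prop := is_matching_number 1.

End HypergraphInvariants.

Section SegmentHypergraphs.
Variable R : realType.

Definition int_point (p : int * int) : R * R := (p.1%:~R, p.2%:~R).

Definition is_line (L : set (R * R)) : Prop :=
  exists a b c : R,
    (a, b) <> (0, 0) /\ L = [set p | a * p.1 + b * p.2 = c].

Definition between (p q z : R * R) : Prop :=
  exists t : R, [/\ 0 <= t <= 1,
    z.1 = (1 - t) * p.1 + t * q.1 & z.2 = (1 - t) * p.2 + t * q.2].

(* "Consecutive" means that no integer point of L is skipped between two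
   points of e. *)
Definition consecutive_on (r : nat) (L : set (R * R)) (e : set (int * int)) :
    Prop :=
  [/\ e #= `I_r, int_point @` e `<=` L &
      forall p q z, e p -> e q -> L (int_point z) ->
        between (int_point p) (int_point q) (int_point z) -> e z].

Definition segment_hypergraph (r : nat) (H : hypergraph (int * int)) : Prop :=
  (forall e, edges H e -> exists2 L, is_line L & consecutive_on r L e) /\
  (forall L, is_line L -> forall e f, edges H e -> edges H f ->
     int_point @` e `<=` L -> int_point @` f `<=` L -> e = f).

End SegmentHypergraphs.

(* Main.v *)
(** Two edges [e1], [e2] of an intersecting family meet in a point [o] and have
    independent directions [d1], [d2].  An edge avoiding [o] meets [e1] and [e2] in
    two different points; these, together with their positions on the edge,
    determine it, so in the affine frame [(o, d1, d2)] there are finitely many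
    possibilities.  Once one edge [e3] avoiding [o] is fixed, an edge through [o]
    is determined in the same way by its intersection with [e3].  A finite
    branching search over these candidates shows that every family of pairwise
    meeting candidates has a cover by three points.  The only facts used about edges
    are that they are 5-term arithmetic progressions, that they pairwise meet, and
    that no two are collinear. *)

From Stdlib Require Import ZArith Lia.
Require Import Defs.
From mathcomp Require Import all_boot all_order all_algebra.
From mathcomp Require Import mathcomp_extra boolp classical_sets functions.
From mathcomp Require Import cardinality reals.
From mathcomp Require Import finmap.
From mathcomp Require Import ring zify ssrZ.

Set Implicit Arguments.
Unset Strict Implicit.
Unset Printing Implicit Defensive.

(* [%Z] would otherwise be the scope of MathComp's unary integers. *)
Delimit Scope Z_scope with Z.

(** * The computable search and its candidate segments *)

Notation point := (Z * Z)%type.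
Notation seg := (seq point).

Definition eqpt (p q : point) : bool := Z.eqb p.1 q.1 && Z.eqb p.2 q.2.
Definition on (c : seg) (p : point) : bool := has (eqpt p) c.
Definition meets (c c' : seg) : bool := has (on c') c.

(* Heuristic: among the triples obtained by repeatedly picking a point on the first
   uncovered segment, one that covers all of [fixed] and leaves as few segments of
   [rest] as possible uncovered.  Nothing is proved about it, since [coverable]
   checks its output. *)
Fixpoint pick_cover (k : nat) (fixed rest : seq seg) (C : seg) : option (nat * seg) :=
  match fixed ++ rest, k with
  | [::], _ => Some (0, C)
  | _, 0 => if fixed is [::] then Some (size rest, C) else None
  | c :: _, k'.+1 =>
    foldl (fun best p =>
      if best is Some (0, _) then best else
      let avoid := filter (fun c' => ~~ on c' p) in
      match best, pick_cover k' (avoid fixed) (avoid rest) (p :: C) with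
      | Some (m, _), Some (n, _) as new => if n < m then new else best
      | None, new => new
      | _, None => best
      end) None c
  end.

Arguments pick_cover : simpl never.

(** Case split on the first segment of [bad] lying in the family. The segments before it are then
    absent, so only [bad' ++ good] remains available. *)
Fixpoint branch (search : seq seg -> seq seg -> bool) (fixed bad good : seq seg) : bool :=
  if bad is c :: bad' then
    search (c :: fixed) (filter (meets c) (bad' ++ good)) && branch search fixed bad' good
  else true.

(* Certifies that every pairwise meeting family contained in [fixed ++ rest] has a
   cover by three points: either [C] is one, or the family contains a first segment
   missed by [C], which then becomes fixed. *)
Fixpoint coverable (fuel : nat) (fixed rest : seq seg) : bool :=
  if fuel is n.+1 then
    if pick_cover 3 fixed rest [::] is Some (_, C) then
      [&& size C <= 3, all (meets C) fixed &
      branch (coverable n) fixed (filter (fun c => ~~ meets C c) rest) (filter (meets C) rest)]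
    else false
  else false.

Local Open Scope Z_scope.
(* The five points [p + (k - i) d], so that [p] has index [i]. *)
Definition progression (p d : point) (i : Z) : seg :=
  [seq (p.1 + (k - i) * d.1, p.2 + (k - i) * d.2) | k <- [:: 0; 1; 2; 3; 4]].

Definition index_pairs : seq (Z * Z) :=
  [:: (0, 1); (0, 2); (0, 3); (0, 4); (1, 2); (1, 3); (1, 4); (2, 3); (2, 4); (3, 4)].

(** One candidate for each choice of positions of [p] and [q]; increasing positions suffice, since a
    progression can be read backwards. The denominator 144 makes the quotients exact wherever this
    is used. *)
Definition through (p q : point) : seq seg :=
  [seq progression p ((q.1 - p.1) / (ij.2 - ij.1), (q.2 - p.2) / (ij.2 - ij.1)) ij.1
  | ij <- index_pairs].

(* The pair [(x, y)] stands for the point [o + (x / 144) d1 + (y / 144) d2].  A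
   candidate avoiding [o] needs denominator 12, one through [o] a further 12. *)
Definition axis1 i := progression (0, 0) (144, 0) i.
Definition axis2 i := progression (0, 0) (0, 144) i.

Definition off_origin i1 i2 : seq seg :=
  flatten [seq through p q | p <- filter (fun p => ~~ eqpt p (0, 0)) (axis1 i1),
                      q <- filter (fun p => ~~ eqpt p (0, 0)) (axis2 i2)].

(** Points of [c] on an axis are skipped: an edge joining such a point to the origin is collinear
    with [e1] or [e2], hence equal to it. *)
Definition through_origin (c : seg) : seq seg :=
  flatten [seq through (0, 0) q | q <- c & ~~ (q.1 =? 0) && ~~ (q.2 =? 0)].

(** The first segment of [bad] in the family becomes the third edge; only then can the edges through
    the origin be enumerated. The fuel 8 merely bounds the depth of the search. *)
Fixpoint triangle_search i1 i2 (bad good : seq seg) : bool :=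
  if bad is c :: bad' then
    coverable 8 [:: axis1 i1; axis2 i2; c]
      (filter (meets c) (bad' ++ good) ++ through_origin c)
    && triangle_search i1 i2 bad' good
  else true.

(* If these three points of [e2] are not a cover, some edge meets [e2] in one of the
   other two points; in particular it avoids [o] and can serve as [e3]. *)
Definition base_cover i2 : seg :=
   (0, 0) :: take 2 (filter (fun p => ~~ eqpt p (0, 0)) (axis2 i2)).

Definition crossing_search i1 i2 : bool :=
  let C := base_cover i2 in
  let l := off_origin i1 i2 in
  triangle_search i1 i2 (filter (fun c => ~~ meets C c) l) (filter (meets C) l).

Local Close Scope Z_scope.

#[local] Arguments Z.add : simpl never.
#[local] Arguments Z.sub : simpl never.
#[local] Arguments Z.mul : simpl never.
#[local] Arguments Z.opp : simpl never.
#[local] Arguments progression : simpl never.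

(** * Soundness of the search *)

Lemma eqptP p q : reflect (p = q) (eqpt p q).
Proof.
case: p q => [a b] [c d]; apply: (iffP andP) => /=.
  by move=> [/Z.eqb_eq -> /Z.eqb_eq ->].
by move=> [-> ->]; rewrite !Z.eqb_refl.
Qed.

Lemma onP c p : on c p = (p \in c).
Proof.
apply/hasP/idP => [[q qc /eqptP ->] //|pc]; by exists p => //; apply/eqptP.
Qed.

Lemma meetsP (c c' : seg) : reflect (exists2 p, p \in c & p \in c') (meets c c').
Proof. by apply: (iffP hasP) => -[p pc pc']; exists p => //; move: pc'; rewrite onP. Qed.

Section SearchSoundness.
Variables (T : Type) (E : T -> Prop) (rep : T -> seg -> Prop).
Variable hit : seg -> T -> Prop.
Hypothesis rep_meets : forall e e' c c', rep e c -> rep e' c' -> meets c c'.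
Hypothesis rep_hit : forall e c C, rep e c -> meets C c -> hit C e.

Definition represented (l : seq seg) e := exists2 c, c \in l & rep e c.
Definition covered C := forall e, E e -> hit C e.

Lemma coverable_sound n fixed rest :
  (forall e, E e -> represented (fixed ++ rest) e) -> coverable n fixed rest ->
  exists2 C : seg, (size C <= 3) & covered C.
Proof.
elim: n fixed rest => // n IHn fixed rest /= Erep.
case: pick_cover => // -[_ C] /and3P[sizeC /allP fixedC].
have: forall e, E e -> represented
    (fixed ++ filter (fun c => ~~ meets C c) rest ++ filter (meets C) rest) e.
  move=> e /Erep[c cin ec]; exists c => //; move: cin.
  by rewrite !mem_cat !mem_filter; case: (meets C c); rewrite ?orbF.
have: all (meets C) (filter (meets C) rest) by apply: filter_all.
move: (filter _ _) (filter (meets C) rest) => bad good /allP goodC {}Erep.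
elim: bad Erep => [|c bad IHbad] /= Erep.
  move=> _; exists C => // e /Erep[c]; rewrite mem_cat => cin ec; apply: rep_hit ec _.
  by case/orP: cin => [/fixedC|/goodC].
move=> /andP[cov_c cov_bad].
have [[e0 e0c]|no_c] := pselect (exists e0, rep e0 c).
  apply: (IHn _ _ _ cov_c) => e /Erep[c' c'in ec']; exists c' => //.
  move: c'in; rewrite !(mem_cat, inE, mem_filter) (rep_meets e0c ec') /=.
  by rewrite orbCA orbA.
apply: IHbad cov_bad => e /Erep[c' c'in ec']; exists c' => //.
move: c'in; rewrite !(mem_cat, inE); case: eqVneq => // eq_c.
by case: no_c; exists e; rewrite -eq_c.
Qed.

Arguments coverable : simpl never.

(** [U] stands for the edges through the origin. They have no candidates until a third edge [c] is
    found; if none is found, [C] covers them along with the segments of [good]. *)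
Lemma triangle_search_sound (U : T -> Prop) i1 i2 bad good C :
  (size C <= 3) -> all (meets C) good ->
  (forall e, E e -> represented (bad ++ good) e \/ U e) ->
  (forall e, U e -> hit C e) ->
  (forall e e' c', U e -> rep e' c' -> c' \in bad ->
     represented [:: axis1 i1, axis2 i2 & through_origin c'] e) ->
  triangle_search i1 i2 bad good ->
  exists2 C : seg, (size C <= 3) & covered C.
Proof.
move=> sizeC /allP goodC Erep UC Urep.
elim: bad Erep Urep => [|c bad IHbad] /= Erep Urep.
  move=> _; exists C => // e /Erep[[c /goodC cin ec]|/UC//]; exact: rep_hit ec cin.
move=> /andP[cov_c cov_bad].
have [[e0 e0c]|no_c] := pselect (exists e0, rep e0 c).
  apply: (coverable_sound _ cov_c) => e /Erep[[c' c'in ec']|Ue].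
    exists c' => //; rewrite !(mem_cat, inE, mem_filter) (rep_meets e0c ec') /=.
    by move: c'in; rewrite !(mem_cat, inE); case: (c' == c); rewrite ?orbT //= => ->; rewrite orbT.
  have [c' c'in ec'] := Urep _ _ _ Ue e0c (mem_head _ _).
  exists c' => //; move: c'in; rewrite !(mem_cat, inE).
  by case/or3P => ->; rewrite ?orbT.
apply: IHbad cov_bad => [e /Erep[[c' c'in ec']|Ue]|e e' c' Ue e'c' c'bad]; last 1 first.
- by apply: Urep Ue e'c' _; rewrite inE c'bad orbT.
- left; exists c' => //; move: c'in; rewrite inE; case: eqVneq => // eq_c.
  by case: no_c; exists e; rewrite -eq_c.
- by right.
Qed.

End SearchSoundness.

(** Nine cases suffice: reversing a direction turns position [i] into [4 - i], so both positions of
    the crossing point may be taken at most 2. *)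
Lemma crossing_search_succeeds :
  all (fun i1 => all (crossing_search i1) [:: 0; 1; 2]%Z) [:: 0; 1; 2]%Z.
Proof. vm_cast_no_check (erefl true). Qed.

Lemma mem_progression p d i x :
  reflect (exists2 k, (0 <= k <= 4)%Z & x = (p.1 + (k - i) * d.1, p.2 + (k - i) * d.2)%Z)
    (x \in progression p d i).
Proof.
apply: (iffP mapP) => -[k kin ->]; exists k => //.
  by move: kin; rewrite !inE => /or4P[|||/orP[]] /eqP ->.
have [-> | [-> | [-> | [-> | ->]]]] : (k = 0 \/ k = 1 \/ k = 2 \/ k = 3 \/ k = 4)%Z by lia.
all: by rewrite !inE eqxx ?orbT.
Qed.

Lemma mem_index_pairs i j :
  (0 <= i)%Z -> (i < j)%Z -> (j <= 4)%Z -> (i, j) \in index_pairs.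
Proof.
move=> i0 ij j4; have : (i = 0 \/ i = 1 \/ i = 2 \/ i = 3)%Z by lia.
have : (j = 1 \/ j = 2 \/ j = 3 \/ j = 4)%Z by lia.
by move=> [|[|[|]]] jE [|[|[|]]] iE; move: ij; rewrite iE jE.
Qed.

Lemma index_pairs_diff i j : (i, j) \in index_pairs -> (1 <= j - i <= 4)%Z.
Proof.
have /allP h : all (fun ij => (1 <=? ij.2 - ij.1) && (ij.2 - ij.1 <=? 4))%Z index_pairs by [].
by move=> /h /=; lia.
Qed.

(** * Edges as progressions, and their coordinates in the frame of two crossing edges *)

Definition cross (d d' : point) : Z := (d.1 * d'.2 - d.2 * d'.1)%Z.

Definition listed (e : point -> Prop) (c : seg) := forall x, e x <-> x \in c.

Lemma listed_eq e c c' : listed e c -> c =i c' -> listed e c'.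
Proof. by move=> ec cc' x; rewrite -cc'. Qed.

Lemma progression_rev p d i :
  progression p d i =i progression p (- d.1, - d.2)%Z (4 - i)%Z.
Proof.
move=> x; apply/mem_progression/mem_progression => /= -[k kin ->];
  exists (4 - k)%Z; [lia| |lia|]; congr pair; lia.
Qed.

Section Geometry.
Variable E : (point -> Prop) -> Prop.
Hypothesis E_listed : forall e, E e ->
  exists p d, d <> (0, 0)%Z /\ listed e (progression p d 0).
Hypothesis E_meet : forall e e', E e -> E e' -> exists x, e x /\ e' x.
Hypothesis E_linear : forall e e' p d i p' d' i', E e -> E e' ->
  listed e (progression p d i) -> listed e' (progression p' d' i') ->
  cross d d' = 0%Z -> e = e'.

Lemma listed_at e p : E e -> e p -> exists d i,
  [/\ d <> (0, 0)%Z, (0 <= i <= 4)%Z & listed e (progression p d i)].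
Proof.
move=> /E_listed[q [d [d0 eq_e]]] /eq_e/mem_progression[k k4 ->].
exists d, k; split => //; apply: listed_eq eq_e _ => x.
apply/mem_progression/mem_progression => /= -[j j4 ->]; exists j => //;
  congr pair; lia.
Qed.

Lemma listed_near e p : E e -> e p -> exists d i,
  [/\ d <> (0, 0)%Z, i \in [:: 0; 1; 2]%Z & listed e (progression p d i)].
Proof.
move=> Ee ep; have [d [i [d0 i4 e_eq]]] := listed_at Ee ep.
have [i2|i2] := Z_le_gt_dec i 2.
  exists d, i; split => //.
  by have [-> | [-> | ->]] : (i = 0 \/ i = 1 \/ i = 2)%Z by lia.
exists (- d.1, - d.2)%Z, (4 - i)%Z; split.
- by move=> [h1 h2]; apply: d0; case: (d) h1 h2 => /= a b ? ?; congr pair; lia.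
- by have [-> | ->] : (i = 3 \/ i = 4)%Z by lia.
- by apply: listed_eq e_eq _; apply: progression_rev.
Qed.

Lemma listed_two e p q : E e -> e p -> e q -> p <> q -> exists d i j,
  [/\ (i, j) \in index_pairs, listed e (progression p d i) &
      q = (p.1 + (j - i) * d.1, p.2 + (j - i) * d.2)%Z].
Proof.
move=> Ee ep eq pq; have [d [i [d0 i4 e_eq]]] := listed_at Ee ep.
have /mem_progression[j j4 qE] := (e_eq q).1 eq.
have ij : i <> j by move=> ij; apply: pq; rewrite qE ij Z.sub_diag !Z.add_0_r; case: (p).
have [lt_ij|ge_ij] := Z_lt_ge_dec i j.
  by exists d, i, j; split => //; apply: mem_index_pairs; lia.
exists (- d.1, - d.2)%Z, (4 - i)%Z, (4 - j)%Z; split => /=.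
- by apply: mem_index_pairs; lia.
- by apply: listed_eq e_eq _; apply: progression_rev.
- by rewrite qE; congr pair; lia.
Qed.

Section Triangle.
Variables (e1 e2 : point -> Prop) (o d1 d2 : point) (i1 i2 : Z).
Hypotheses (E1 : E e1) (E2 : E e2) (det_neq0 : cross d1 d2 <> 0%Z).
Hypotheses (e1_listed : listed e1 (progression o d1 i1)).
Hypotheses (e2_listed : listed e2 (progression o d2 i2)).
Hypotheses (i1_small : i1 \in [:: 0; 1; 2]%Z) (i2_small : i2 \in [:: 0; 1; 2]%Z).

(** The affine coordinates are cleared of denominators to stay in [Z]; a code need not correspond to
    any lattice point. *)
Definition codes (s p : point) : Prop :=
  (144 * p.1 = 144 * o.1 + s.1 * d1.1 + s.2 * d2.1 /\
   144 * p.2 = 144 * o.2 + s.1 * d1.2 + s.2 * d2.2)%Z.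

Lemma codes_inj s s' p : codes s p -> codes s' p -> s = s'.
Proof.
case: s s' => a b [a' b'] [/= h1 h2] [/= h1' h2'].
have g1 : ((a - a') * d1.1 + (b - b') * d2.1 = 0)%Z by lia.
have g2 : ((a - a') * d1.2 + (b - b') * d2.2 = 0)%Z by lia.
(* Cramer's rule: each coordinate difference is killed by the nonzero determinant. *)
have k1 : ((a - a') * cross d1 d2 = 0)%Z.
  transitivity (((a - a') * d1.1 + (b - b') * d2.1) * d2.2
                - ((a - a') * d1.2 + (b - b') * d2.2) * d2.1)%Z; first by rewrite /cross; ring.
  by rewrite g1 g2.
have k2 : ((b - b') * cross d1 d2 = 0)%Z.
  transitivity (((a - a') * d1.2 + (b - b') * d2.2) * d1.1
                - ((a - a') * d1.1 + (b - b') * d2.1) * d1.2)%Z; first by rewrite /cross; ring.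
  by rewrite g1 g2.
by move/Z.mul_eq_0: k1 => [?|//]; move/Z.mul_eq_0: k2 => [?|//]; congr pair; lia.
Qed.

Lemma codes_fun s p p' : codes s p -> codes s p' -> p = p'.
Proof. by case: p p' => a b [a' b'] [/= h1 h2] [/= h1' h2']; congr pair; lia. Qed.

Definition rep (e : point -> Prop) (c : seg) : Prop :=
  [/\ E e, forall p, e p -> exists2 s, s \in c & codes s p &
      forall s, s \in c -> exists2 p, e p & codes s p].

Lemma rep_meets e e' c c' : rep e c -> rep e' c' -> meets c c'.
Proof.
move=> [Ee ec _] [Ee' ec' _]; have [p [ep e'p]] := E_meet Ee Ee'.
have [s sc sp] := ec _ ep; have [s' sc' sp'] := ec' _ e'p.
by apply/meetsP; exists s; rewrite // (codes_inj sp sp').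
Qed.

Lemma rep_progression e p d i s t : E e -> listed e (progression p d i) -> codes s p ->
  (144 * d.1 = t.1 * d1.1 + t.2 * d2.1)%Z -> (144 * d.2 = t.1 * d1.2 + t.2 * d2.2)%Z ->
  rep e (progression s t i).
Proof.
move=> Ee e_eq [sp1 sp2] t1 t2.
have code k : codes (s.1 + (k - i) * t.1, s.2 + (k - i) * t.2)%Z
                    (p.1 + (k - i) * d.1, p.2 + (k - i) * d.2)%Z.
  by split => /=; nia.
split=> // [x /e_eq/mem_progression[k k4 ->]|x /mem_progression[k k4 ->]].
  by eexists; last exact: code; apply/mem_progression; exists k.
by eexists; last exact: code; apply/e_eq/mem_progression; exists k.
Qed.

Lemma rep_axis1 : rep e1 (axis1 i1).
Proof. by apply: rep_progression e1_listed _ _ _ => //=; [split => /=|..]; lia. Qed.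

Lemma rep_axis2 : rep e2 (axis2 i2).
Proof. by apply: rep_progression e2_listed _ _ _ => //=; [split => /=|..]; lia. Qed.

(* 12 is the least common multiple of the possible index differences 1, 2, 3, 4. *)
Lemma rep_through e p q s t : E e -> e p -> e q -> p <> q -> codes s p -> codes t q ->
  (12 | t.1 - s.1)%Z -> (12 | t.2 - s.2)%Z -> represented rep (through s t) e.
Proof.
move=> Ee ep eq pq sp tq [m1 m1E] [m2 m2E].
have [d [i [j [ij e_eq qE]]]] := listed_two Ee ep eq pq.
eexists; first by apply/mapP; exists (i, j).
rewrite /= m1E m2E.
have [n nE] : exists n, (n * (j - i) = 12)%Z.
  have := index_pairs_diff ij => ?.
  have : (j - i = 1 \/ j - i = 2 \/ j - i = 3 \/ j - i = 4)%Z by lia.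
  by move=> [->|[->|[->|->]]]; [exists 12%Z|exists 6%Z|exists 4%Z|exists 3%Z].
have ij0 : (j - i <> 0)%Z by nia.
have -> : (m1 * 12 / (j - i) = m1 * n)%Z by rewrite -nE Z.mul_assoc Z.div_mul.
have -> : (m2 * 12 / (j - i) = m2 * n)%Z by rewrite -nE Z.mul_assoc Z.div_mul.
case: sp tq => [sp1 sp2]; rewrite qE => -[/= tq1 tq2].
apply: rep_progression => //=; apply: (Z.mul_reg_l _ _ _ ij0).
  by transitivity (m1 * (n * (j - i)) * d1.1 + m2 * (n * (j - i)) * d2.1)%Z; [rewrite nE; lia|lia].
by transitivity (m1 * (n * (j - i)) * d1.2 + m2 * (n * (j - i)) * d2.2)%Z; [rewrite nE; lia|lia].
Qed.

Lemma codes_origin : codes (0, 0)%Z o.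
Proof. by split => /=; lia. Qed.

Lemma axis1E i s : s \in axis1 i -> exists m, s = (144 * m, 0)%Z.
Proof. by move=> /mem_progression[k _ ->]; exists (k - i)%Z; congr pair => /=; lia. Qed.

Lemma axis2E i s : s \in axis2 i -> exists m, s = (0, 144 * m)%Z.
Proof. by move=> /mem_progression[k _ ->]; exists (k - i)%Z; congr pair => /=; lia. Qed.

Lemma rep_off_origin e : E e -> ~ e o -> represented rep (off_origin i1 i2) e.
Proof.
move=> Ee eo; have [p [ep e1p]] := E_meet Ee E1; have [q [eq e2q]] := E_meet Ee E2.
have [_ /(_ _ e1p)[s s1 sp] _] := rep_axis1; have [_ /(_ _ e2q)[t t2 tq] _] := rep_axis2.
have s0 : s <> (0, 0)%Z by move=> s0; apply: eo; rewrite (codes_fun codes_origin (p' := p)) // -s0.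
have t0 : t <> (0, 0)%Z by move=> t0; apply: eo; rewrite (codes_fun codes_origin (p' := q)) // -t0.
have [[m sE] [n tE]] := (axis1E s1, axis2E t2).
(* The two axes share only the origin, so a common point would have code [(0, 0)]. *)
have pq : p <> q.
  move=> pq; rewrite -{}pq in tq; move: (codes_inj sp tq); rewrite sE tE => -[m0 _].
  by apply: s0; rewrite sE m0.
have [||c cin ec] := rep_through Ee ep eq pq sp tq.
- by rewrite sE tE; exists (- 12 * m)%Z => /=; lia.
- by rewrite sE tE; exists (12 * n)%Z => /=; lia.
exists c => //; apply/flattenP; exists (through s t) => //.
apply/allpairsP; exists (s, t); split => //; rewrite mem_filter ?s1 ?t2 andbT; exact/eqptP.
Qed.

(** The steps of such a candidate are multiples of [144 / (j - i)], which is 12 times the integer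
    [12 / (j - i)]. This makes the second round of divisions, in [through_origin], exact. *)
Lemma off_origin_dvd c s : c \in off_origin i1 i2 -> s \in c -> (12 | s.1)%Z /\ (12 | s.2)%Z.
Proof.
move=> /flattenP[_ /allpairsP[pq [+ + ->]]].
rewrite !mem_filter => /andP[_ /axis1E[m ->]] /andP[_ /axis2E[n ->]].
move=> /mapP[[i j] ij ->] /mem_progression[k _ ->] /=.
have [g gE] : exists g, (12 * g * (j - i) = 144)%Z.
  have := index_pairs_diff ij => ?.
  have : (j - i = 1 \/ j - i = 2 \/ j - i = 3 \/ j - i = 4)%Z by lia.
  by move=> [->|[->|[->|->]]]; [exists 12%Z|exists 6%Z|exists 4%Z|exists 3%Z].
have ij0 : (j - i <> 0)%Z by nia.
have -> : (0 - 144 * m = (- m * (12 * g)) * (j - i))%Z by rewrite -gE; ring.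
have -> : (144 * n - 0 = (n * (12 * g)) * (j - i))%Z by rewrite -gE; ring.
rewrite !Z.div_mul //; split.
  by exists (12 * m - (k - i) * m * g)%Z; ring.
by exists ((k - i) * n * g)%Z; ring.
Qed.

(** The vector from [o] to [q] is a nonzero multiple of the direction of [e] and is parallel to [d],
    so the two edges are collinear. *)
Lemma collinear_origin e e' q d i n : E e -> E e' -> e o -> e q -> o <> q ->
  listed e' (progression o d i) ->
  (144 * q.1 = 144 * o.1 + n * d.1)%Z -> (144 * q.2 = 144 * o.2 + n * d.2)%Z -> e = e'.
Proof.
move=> Ee Ee' eo eq oq e'_eq; have [d' [k [l [kl e_eq ->]]]] := listed_two Ee eo eq oq.
move=> /= h1 h2; apply: E_linear e_eq e'_eq _ => //.
have := index_pairs_diff kl => ?.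
have {}h1 : (144 * (l - k) * d'.1 = n * d.1)%Z by lia.
have {}h2 : (144 * (l - k) * d'.2 = n * d.2)%Z by lia.
apply: (Z.mul_reg_l _ _ (144 * (l - k))); first by lia.
transitivity (144 * (l - k) * d'.1 * d.2 - 144 * (l - k) * d'.2 * d.1)%Z.
  by rewrite /cross; ring.
by rewrite h1 h2; ring.
Qed.

Lemma rep_through_origin e e' c' : E e -> e o -> rep e' c' -> ~ e' o ->
  c' \in off_origin i1 i2 ->
  represented rep [:: axis1 i1, axis2 i2 & through_origin c'] e.
Proof.
move=> Ee eo [Ee' e'c' _] e'o c'in.
have [q [eq e'q]] := E_meet Ee Ee'; have [t tc' tq] := e'c' _ e'q.
have oq : o <> q by move=> oq; rewrite oq in e'o.
have [tq1 tq2] := tq.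
have [t1|t1] := eqVneq t.1 0%Z.
  have -> : e = e2.
    by apply: (collinear_origin (n := t.2) Ee _ eo eq oq e2_listed) => //; rewrite ?tq1 ?tq2 t1 Z.mul_0_l Z.add_0_r.
  by exists (axis2 i2); [rewrite !inE eqxx orbT | exact: rep_axis2].
have [t2|t2] := eqVneq t.2 0%Z.
  have -> : e = e1.
    by apply: (collinear_origin (n := t.1) Ee _ eo eq oq e1_listed) => //; rewrite ?tq1 ?tq2 t2 Z.mul_0_l Z.add_0_r.
  by exists (axis1 i1); [rewrite !inE eqxx | exact: rep_axis1].
have [d1t d2t] := off_origin_dvd c'in tc'.
have [||c cin ec] := rep_through Ee eo eq oq codes_origin tq; [by rewrite Z.sub_0_r..|].
exists c => //; rewrite !inE; apply/or3P/Or33.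
apply/flattenP; exists (through (0, 0)%Z t) => //.
by apply/mapP; exists t => //; rewrite mem_filter tc' andbT; apply/andP; split; apply/negP => /Z.eqb_eq; apply/eqP.
Qed.

(** The division is exact on codes of lattice points. Other codes decode to arbitrary points,
    harmlessly: an edge is only ever hit through the code of one of its own points. *)
Definition decode (s : point) : point :=
  ((144 * o.1 + s.1 * d1.1 + s.2 * d2.1) / 144, (144 * o.2 + s.1 * d1.2 + s.2 * d2.2) / 144)%Z.

Lemma codesK s p : codes s p -> decode s = p.
Proof.
by case: p => a b [/= h1 h2]; rewrite /decode -h1 -h2 !(Z.mul_comm 144) !Z.div_mul.
Qed.

Definition hit (C : seg) (e : point -> Prop) : Prop := exists2 s, s \in C & e (decode s).

Lemma rep_hit e c C : rep e c -> meets C c -> hit C e.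
Proof.
move=> [_ _ ec] /meetsP[s sC /ec[p ep /codesK sp]]; by exists s; rewrite ?sp.
Qed.

Lemma triangle_cover : exists2 C : seg, size C <= 3 & forall e, E e -> exists2 p, p \in C & e p.
Proof.
have searchT : crossing_search i1 i2 by move/allP: crossing_search_succeeds => /(_ _ i1_small)/allP/(_ _ i2_small).
have [|||||C sizeC hitC] := triangle_search_sound (E := E) rep_meets rep_hit
  (U := fun e => E e /\ e o) (C := base_cover i2) _ _ _ _ _ searchT.
- by rewrite [size _]/= ltnS size_take_min geq_minl.
- exact: filter_all.
- move=> e Ee; have [eo|/(rep_off_origin Ee)[c cin ec]] := pselect (e o); [by right|left].
  by exists c => //; rewrite mem_cat !mem_filter cin; case: (meets _ c).
- move=> e [Ee eo]; exists (0, 0)%Z; first by rewrite inE eqxx.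
  by rewrite (codesK codes_origin).
(* A segment missing [base_cover] misses the origin in particular, so [e'] avoids [o]. *)
- move=> e e' c' [Ee eo] e'c'; rewrite mem_filter => /andP[avoid c'in].
  apply: rep_through_origin (e'c') _ c'in => // e'o; case/negP: avoid; apply/meetsP.
  have [_ /(_ _ e'o)[s sc' so] _] := e'c'; exists s => //.
  by rewrite (codes_inj so codes_origin) inE eqxx.
exists (map decode C); first by rewrite size_map.
by move=> e /hitC[s sC es]; exists (decode s) => //; apply: map_f.
Qed.

End Triangle.

Theorem cover_of_progressions :
  exists2 C : seg, size C <= 3 & forall e, E e -> exists2 p, p \in C & e p.
Proof.
have [[e1 [e2 [E1 E2 e12]]]|E_sub] := pselect (exists e1 e2, [/\ E e1, E e2 & e1 <> e2]).
  have [o [e1o e2o]] := E_meet E1 E2.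
  have [d1 [i1 [d1_0 i1s e1_eq]]] := listed_near E1 e1o.
  have [d2 [i2 [d2_0 i2s e2_eq]]] := listed_near E2 e2o.
  apply: (triangle_cover E1 E2 _ e1_eq e2_eq) => // d12; apply: e12.
  exact: E_linear e1_eq e2_eq d12.
(* With at most one edge, a single point or the empty list is a cover. *)
have [[e0 E0]|no_e] := pselect (exists e, E e).
  have [p [e0p _]] := E_meet E0 E0; exists [:: p] => // e Ee; exists p; rewrite ?inE //.
  by case: (pselect (e = e0)) => [->//|ne]; case: E_sub; exists e, e0.
by exists [::] => // e Ee; case: no_e; exists e.
Qed.

End Geometry.

(** * From consecutive lattice points on a line to arithmetic progressions *)

Lemma five_consecutive (s : seq Z) : uniq s -> size s = 5 ->
  (forall a b k, a \in s -> b \in s -> (a <= k <= b)%Z -> k \in s) ->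
  exists a, forall k, k \in s <-> (a <= k <= a + 4)%Z.
Proof.
move=> s_uniq s5 s_conv.
have [leT_tot leT_trans] : total Z.leb /\ transitive Z.leb by split=> [x y|y x z]; lia.
have := sort_sorted leT_tot s; have := mem_sort Z.leb s.
have := size_sort Z.leb s; rewrite s5; have := sort_uniq Z.leb s; rewrite s_uniq.
case: (sort Z.leb s) => // a [|b [|c [|d [|e [|//]]]]] // abcde_uniq _ mem_s.
have {s_conv} s_conv x y k : x \in [:: a; b; c; d; e] -> y \in [:: a; b; c; d; e] ->
    (x <= k <= y)%Z -> k \in [:: a; b; c; d; e].
  by rewrite !mem_s; apply: s_conv.
move=> /= /and5P[ab bc cd de _].
have memE k : reflect (k = a \/ k = b \/ k = c \/ k = d \/ k = e) (k \in [:: a; b; c; d; e]).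
  rewrite !inE; apply: (iffP or4P) => [[/eqP|/eqP|/eqP|/orP[]/eqP]|]; [tauto..|].
  by move=> [->|[->|[->|[->|->]]]]; [apply: Or41|apply: Or42|apply: Or43|apply: Or44|apply: Or44];
    rewrite eqxx ?orbT.
move: abcde_uniq; rewrite /= !inE !negb_or => /and5P[/and4P[/eqP ab' _ _ _] /and3P[/eqP bc' _ _] /andP[/eqP cd' _] /eqP de' _].
have next k : (a <= k <= e)%Z -> k = a \/ k = b \/ k = c \/ k = d \/ k = e.
  by move=> ake; apply/memE/(s_conv a e) => //; apply/memE; tauto.
(* In sorted order, the successor of each of the first four entries is still at most [e], hence
   listed; so each gap equals 1. *)
have := next (a + 1)%Z; have := next (b + 1)%Z; have := next (c + 1)%Z; have := next (d + 1)%Z.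
move=> nd nc nb na; exists a => k; rewrite -mem_s; split => [/memE|] H; first by lia.
by apply/memE; lia.
Qed.

(** Dividing the difference of two points by its gcd gives a primitive direction. A Bezout relation
    then gives an integer coordinate on the line, in which the points of [f] are five consecutive
    integers. *)
Lemma consecutive_listed (f : point -> Prop) (s : seg) :
  uniq s -> size s = 5 -> (forall x, f x <-> x \in s) ->
  (forall p q x, f p -> f q -> f x -> cross (q.1 - p.1, q.2 - p.2)%Z (x.1 - p.1, x.2 - p.2)%Z = 0%Z) ->
  (forall p d k m, f p -> f (p.1 + m * d.1, p.2 + m * d.2)%Z -> (0 <= k <= m)%Z ->
     f (p.1 + k * d.1, p.2 + k * d.2)%Z) ->
  exists p d, d <> (0, 0)%Z /\ listed f (progression p d 0).
Proof.
move=> s_uniq s5 fs f_col f_conv.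
have [p [q [fp fq pq]]] : exists p q, [/\ f p, f q & p <> q].
  case: s s_uniq s5 fs {f_col f_conv} => [|p [|q s]] //= /andP[+ _] _ fs.
  rewrite inE negb_or => /andP[/eqP pq _]; exists p, q.
  by split=> //; apply/fs; rewrite !inE eqxx ?orbT.
pose g := Z.gcd (q.1 - p.1) (q.2 - p.2).
have [d1 d1E] := Z.gcd_divide_l (q.1 - p.1) (q.2 - p.2).
have [d2 d2E] := Z.gcd_divide_r (q.1 - p.1) (q.2 - p.2).
have [u [v uv]] := Z.gcd_bezout (q.1 - p.1) (q.2 - p.2) g erefl.
rewrite -/g in d1E d2E uv.
have g0 : g <> 0%Z.
  by move=> g0; apply: pq; rewrite g0 in d1E d2E; case: (p) (q) d1E d2E => ? ? [? ?] /= *; congr pair; lia.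
have {}uv : (u * d1 + v * d2 = 1)%Z.
  by apply: (Z.mul_reg_l _ _ g) => //; transitivity (u * (d1 * g) + v * (d2 * g))%Z; [ring|rewrite -d1E -d2E; lia].
(* By [u * d1 + v * d2 = 1], this linear form inverts the parametrization [at_]. *)
pose coord (x : point) := (u * (x.1 - p.1) + v * (x.2 - p.2))%Z.
pose at_ k : point := (p.1 + k * d1, p.2 + k * d2)%Z.
have coordK x : f x -> at_ (coord x) = x.
  move=> fx; have := f_col p q x fp fq fx; rewrite /cross /= d1E d2E => col.
  have {}col : (d1 * (x.2 - p.2) = d2 * (x.1 - p.1))%Z by apply: (Z.mul_reg_l _ _ g) => //; lia.
  have x1 : (coord x * d1 = x.1 - p.1)%Z.
    transitivity ((u * d1) * (x.1 - p.1) + v * (d1 * (x.2 - p.2)))%Z; first by rewrite /coord; ring.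
    by rewrite col; transitivity ((u * d1 + v * d2) * (x.1 - p.1))%Z; [ring|rewrite uv; ring].
  have x2 : (coord x * d2 = x.2 - p.2)%Z.
    transitivity (u * (d2 * (x.1 - p.1)) + v * d2 * (x.2 - p.2))%Z; first by rewrite /coord; ring.
    by rewrite -col; transitivity ((u * d1 + v * d2) * (x.2 - p.2))%Z; [ring|rewrite uv; ring].
  by rewrite /at_ x1 x2; case: (x) => a b /=; congr pair; lia.
have atK k : coord (at_ k) = k.
  by rewrite /coord /=; transitivity (k * (u * d1 + v * d2))%Z; [ring|rewrite uv; ring].
have f_at k : f (at_ k) <-> k \in map coord s.
  split=> [/fs fk|/mapP[x /fs fx ->]]; last by rewrite coordK.
  by rewrite -[k]atK; apply: map_f.
have [|||a aP] := @five_consecutive (map coord s).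
- rewrite map_inj_in_uniq // => x y /fs fx /fs fy xy.
  by rewrite -(coordK x fx) -(coordK y fy) xy.
- by rewrite size_map.
- move=> b c k /f_at fb /f_at fc bkc; apply/f_at.
  have := f_conv (at_ b) (d1, d2) (k - b)%Z (c - b)%Z fb.
  rewrite /at_ /=; set x := (X in f X -> _); set y := (X in _ -> _ -> f X).
  have -> : x = at_ c by congr pair; lia.
  by have -> : y = at_ k; [congr pair; lia | apply; [|lia]].
exists (at_ a), (d1, d2); split; first by move=> [d10 d20]; rewrite d10 d20 in uv; lia.
move=> x; split=> [fx|/mem_progression[k k4 ->]].
  have fk : f (at_ (coord x)) by rewrite coordK.
  apply/mem_progression; exists (coord x - a)%Z; first by move/f_at/aP: fk; lia.
  by rewrite -{1}[x]coordK //; congr pair => /=; lia.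
have -> : ((at_ a).1 + (k - 0) * d1, (at_ a).2 + (k - 0) * d2)%Z = at_ (a + k)%Z.
  by congr pair => /=; lia.
by apply/f_at/aP; lia.
Qed.

(** * Transfer between [Z], MathComp integers and real lines *)

Import Order.TTheory GRing.Theory Num.Theory.
Local Open Scope classical_set_scope.
Local Open Scope card_scope.
Local Open Scope ring_scope.

Definition to_int (x : point) : int * int := (int_of_Z x.1, int_of_Z x.2).
Definition of_int (z : int * int) : point := (Z_of_int z.1, Z_of_int z.2).

Lemma to_intK : cancel to_int of_int.
Proof. by case=> a b; rewrite /of_int /= !int_of_ZK. Qed.

Lemma of_intK : cancel of_int to_int.
Proof. by case=> a b; rewrite /to_int /= !Z_of_intK. Qed.

Section RealLines.
Variable R : realType.
Local Notation int_point := (int_point R).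

Definition ZtoR (k : Z) : R := (int_of_Z k)%:~R.

Lemma ZtoR_inj : injective ZtoR.
Proof. by move=> a b /intr_inj/(can_inj int_of_ZK). Qed.

Lemma ZtoRD a b : ZtoR (a + b)%Z = ZtoR a + ZtoR b.
Proof. by rewrite /ZtoR -intrD -rmorphD. Qed.

Lemma ZtoRB a b : ZtoR (a - b)%Z = ZtoR a - ZtoR b.
Proof. by rewrite /ZtoR -intrB -rmorphB. Qed.

Lemma ZtoRM a b : ZtoR (a * b)%Z = ZtoR a * ZtoR b.
Proof. by rewrite /ZtoR -intrM -rmorphM. Qed.

Lemma ler_ZtoR a b : (a <= b)%Z -> ZtoR a <= ZtoR b.
Proof. by move=> ab; rewrite ler_int; lia. Qed.

Lemma ZtoR_ge0 a : (0 <= a)%Z -> 0 <= ZtoR a.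
Proof. exact: ler_ZtoR. Qed.

(** The nonzero normal [(a, b)] is orthogonal to both difference vectors, so [a] and [b] both
    annihilate their determinant. *)
Lemma line_cross (L : set (R * R)) (p q x : point) : is_line L ->
  L (int_point (to_int p)) -> L (int_point (to_int q)) -> L (int_point (to_int x)) ->
  cross (q.1 - p.1, q.2 - p.2)%Z (x.1 - p.1, x.2 - p.2)%Z = 0%Z.
Proof.
move=> [a [b [c [ab0 ->]]]] /= Lp Lq Lx; apply: ZtoR_inj.
rewrite /cross /= !(ZtoRB, ZtoRM) -/(ZtoR 0%Z).
rewrite -!/(ZtoR _) in Lp Lq Lx; have {}Lq : a * (ZtoR q.1 - ZtoR p.1) + b * (ZtoR q.2 - ZtoR p.2) = 0.
  by rewrite -(subrr c) -{1}Lq -Lp; ring.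
have {}Lx : a * (ZtoR x.1 - ZtoR p.1) + b * (ZtoR x.2 - ZtoR p.2) = 0.
  by rewrite -(subrr c) -{1}Lx -Lp; ring.
set D := (X in X = _).
have aD : a * D = 0.
  transitivity ((a * (ZtoR q.1 - ZtoR p.1) + b * (ZtoR q.2 - ZtoR p.2)) * (ZtoR x.2 - ZtoR p.2)
    - (a * (ZtoR x.1 - ZtoR p.1) + b * (ZtoR x.2 - ZtoR p.2)) * (ZtoR q.2 - ZtoR p.2)).
    by rewrite /D; ring.
  by rewrite Lq Lx; ring.
have bD : b * D = 0.
  transitivity ((a * (ZtoR x.1 - ZtoR p.1) + b * (ZtoR x.2 - ZtoR p.2)) * (ZtoR q.1 - ZtoR p.1)
    - (a * (ZtoR q.1 - ZtoR p.1) + b * (ZtoR q.2 - ZtoR p.2)) * (ZtoR x.1 - ZtoR p.1)).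
    by rewrite /D; ring.
  by rewrite Lq Lx; ring.
have [//|D0] := eqVneq D 0; case: ab0.
by congr pair; apply: (mulIf D0); rewrite mul0r.
Qed.

Lemma line_convex (L : set (R * R)) (p d : point) k m : is_line L ->
  L (int_point (to_int p)) ->
  L (int_point (to_int (p.1 + m * d.1, p.2 + m * d.2)%Z)) -> (0 <= k <= m)%Z ->
  let z := (p.1 + k * d.1, p.2 + k * d.2)%Z in
  L (int_point (to_int z)) /\
  Defs.between (int_point (to_int p)) (int_point (to_int (p.1 + m * d.1, p.2 + m * d.2)%Z))
          (int_point (to_int z)).
Proof.
move=> Lline Lp Lq [k0 km] z.
suff between_z : Defs.between (int_point (to_int p))
    (int_point (to_int (p.1 + m * d.1, p.2 + m * d.2)%Z)) (int_point (to_int z)).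
  split=> //; move: Lline Lp Lq between_z => [a [b [c [_ ->]]]]; rewrite /mkset => Lp Lq [t [_ -> ->]].
  transitivity ((1 - t) * c + t * c); last by ring.
  by rewrite -{1}Lp -Lq; ring.
rewrite /Defs.between /= -!/(ZtoR _) !(ZtoRD, ZtoRM).
(* The parameter is [k / m]; when [m = 0] the three points coincide and 0 serves. *)
have [m0|m0] := eqVneq m 0%Z.
  have -> : k = 0%Z by lia.
  by exists 0; rewrite m0 lexx ler01; split=> //; ring.
have mR0 : ZtoR m != 0 by apply: contra_neq m0 => /(ZtoR_inj (x2 := 0%Z)).
have mR_gt0 : 0 < ZtoR m by rewrite lt_neqAle eq_sym mR0 ZtoR_ge0 //; lia.
exists (ZtoR k / ZtoR m); split.
- by rewrite divr_ge0 ?ler_pdivrMr ?mul1r ?ler_ZtoR ?ZtoR_ge0 //; lia.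
- by field.
- by field.
Qed.

Definition direction_line (o d : point) : set (R * R) :=
  [set p | ZtoR d.2 * p.1 + (- ZtoR d.1) * p.2 = ZtoR d.2 * ZtoR o.1 + (- ZtoR d.1) * ZtoR o.2].

Lemma is_line_direction o d : d <> (0, 0)%Z -> is_line (direction_line o d).
Proof.
move=> d0; exists (ZtoR d.2), (- ZtoR d.1), (ZtoR d.2 * ZtoR o.1 + (- ZtoR d.1) * ZtoR o.2).
split=> // -[/(ZtoR_inj (x2 := 0%Z)) d20 /eqP]; rewrite oppr_eq0 => /eqP/(ZtoR_inj (x2 := 0%Z)) d10.
by apply: d0; case: (d) d10 d20 => ? ? /= -> ->.
Qed.

Lemma direction_lineP o d z : (d.2 * (z.1 - o.1) = d.1 * (z.2 - o.2))%Z ->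
  direction_line o d (int_point (to_int z)).
Proof.
move=> /(congr1 ZtoR); rewrite !(ZtoRM, ZtoRB) /direction_line /= -!/(ZtoR _) => zo.
transitivity (ZtoR d.2 * (ZtoR z.1 - ZtoR o.1) + ZtoR d.2 * ZtoR o.1 - ZtoR d.1 * ZtoR z.2).
  by ring.
by rewrite zo; ring.
Qed.

End RealLines.

Lemma card_seq_le (T : choiceType) (s : seq T) : [set` s] #<= `I_(size s).
Proof.
have -> : [set` s] = [set` [fset x in s]%fset] by apply/seteqP; split=> x /=; rewrite inE.
have /card_eq_fsetP/card_le_eql -> := card_fseq s.
by rewrite card_le_II size_undup.
Qed.

Lemma progression_parallel p d i x y d' :
  x \in progression p d i -> y \in progression p d i -> cross d' d = 0%Z ->
  (d'.2 * (x.1 - y.1) = d'.1 * (x.2 - y.2))%Z.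
Proof.
move=> /mem_progression[k _ ->] /mem_progression[l _ ->]; rewrite /cross /= => dd'.
transitivity ((k - l) * (d'.2 * d.1))%Z; first by ring.
have -> : (d'.2 * d.1 = d'.1 * d.2)%Z by lia.
by ring.
Qed.

(** * Consequences of the definitions of matching and covering numbers *)

Section Numbers.
Variables (T : Type) (H : hypergraph T).

(** Two distinct disjoint edges would form a matching that injects into a one-element set.
    Nonemptiness handles the case [e = f]. *)
Lemma intersecting_meet e f : intersecting H -> edges H e -> edges H f ->
  e !=set0 -> e `&` f !=set0.
Proof.
move=> [_ max1] He Hf e0; have [<-|ef] := pselect (e = f); first by rewrite setIid.
apply/set0P/negP => /eqP ef0.
have /max1/pcard_leP[g] : matching H [set e; f].
  split=> [x [->|->] //|x y [->|->] [->|->] // [z [zx zy]]].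
    by have : set0 z by rewrite -ef0.
  by have : set0 z by rewrite -ef0.
apply: ef; have [ge gf] : g e = 0%N /\ g f = 0%N.
  have ltg x : [set e; f] x -> (g x < 1)%N by move=> /'funS_g.
  by split; apply/eqP; rewrite -leqn0 -ltnS; apply: ltg; [left|right].
by apply: 'inj_g; [apply/mem_set; left|apply/mem_set; right|exact: etrans ge (esym gf)].
Qed.

(** The covering number is the least size of a finite covering; infinite coverings dominate every
    finite set. *)
Lemma covering_number_le C n : covering H C -> C #<= `I_n ->
  exists2 t, is_covering_number H t & (t <= n)%N.
Proof.
move=> HC Cn; have /finite_setP[m Cm] : finite_set C by apply/finite_set_leP; exists n.
have exP : exists k, `[< exists2 D, covering H D & D #= `I_k >].
  by exists m; apply/asboolP; exists C.
case: (ex_minnP exP) => t /asboolP covt mint; exists t; last first.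
  apply: (@leq_trans m); first by apply: mint; apply/asboolP; exists C.
  by rewrite -card_le_II -(card_le_eql Cm).
split=> // D HD; have [/finite_setP[k Dk]|/infiniteP] := pselect (finite_set D).
  by rewrite (card_le_eqr Dk) card_le_II mint //; apply/asboolP; exists D.
by apply: card_le_trans; apply: subset_card_le.
Qed.

End Numbers.

Theorem theorem4p7 (R : realType) (H : hypergraph (int * int))
    (hseg : segment_hypergraph R 5 H) (hint : intersecting H) :
  exists2 t : nat, is_covering_number H t & (t <= 3)%N.
Proof.
have [seg_edges line_edges] := hseg.
have edge0 e : edges H e -> e !=set0.
  move=> /seg_edges[L _ [e5 _ _]]; apply/set0P/negP => /eqP e0.
  by move: e5; rewrite e0 card_eq_sym card_eq0 => /eqP/IIn_eq0.
pose trace (e : set (int * int)) : point -> Prop := fun x => e (to_int x).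
have edge_listed e : edges H e ->
    exists p d, d <> (0, 0)%Z /\ listed (trace e) (progression p d 0).
  move=> /seg_edges[L Lline [e5 eL e_conv]].
  have /finite_fsetP[X eX] : finite_set e by apply/finite_setP; exists 5%N.
  have X5 : size X = 5%N by apply/card_eq_fsetP; rewrite -eX.
  have traceL x : trace e x -> L (int_point R (to_int x)) by move=> ex; apply: eL; exists (to_int x).
  apply: (@consecutive_listed _ (map of_int X)).
  - by rewrite (map_inj_uniq (can_inj of_intK)) fset_uniq.
  - by rewrite size_map.
  - move=> x; rewrite /trace eX /=; split=> [xX|/mapP[z zX ->]]; last by rewrite of_intK.
    by rewrite -[x]to_intK; apply: map_f.
  - by move=> p q x /traceL Lp /traceL Lq /traceL Lx; apply: line_cross Lline Lp Lq Lx.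
  - move=> p d k m ep eq km; have [Lz zb] := line_convex Lline (traceL _ ep) (traceL _ eq) km.
    exact: e_conv ep eq Lz zb.
have [|||C C3 Ccov] := @cover_of_progressions (fun f => exists2 e, edges H e & f = trace e).
- by move=> _ [e /edge_listed ? ->].
- move=> _ _ [e He ->] [f Hf ->].
  have [z [ez fz]] := intersecting_meet hint He Hf (edge0 _ He).
  by exists (of_int z); rewrite /trace of_intK.
- move=> _ _ p d i p' d' i' [e He ->] [f Hf ->] e_eq f_eq dd'; congr trace.
  have [z [ez fz]] := intersecting_meet hint He Hf (edge0 _ He).
  rewrite -(of_intK z) in ez fz; set o := of_int z in ez fz.
  (* With [d] zero the progression would be the single point [p], although the edge has five
     points. *)
  have d0 : d <> (0, 0)%Z.
    move=> d0; have [q [c [c0 e_qc]]] := edge_listed _ He; apply: c0.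
    have at_p k : (0 <= k <= 4)%Z -> (q.1 + (k - 0) * c.1, q.2 + (k - 0) * c.2)%Z = p.
      move=> k4; have /e_eq/mem_progression[j _ ->] :
          trace e (q.1 + (k - 0) * c.1, q.2 + (k - 0) * c.2)%Z.
        by apply/e_qc/mem_progression; exists k.
      by rewrite d0; case: (p) => ? ?; congr pair => /=; lia.
    have p0 : (0 <= 0 <= 4)%Z by []; have p1 : (0 <= 1 <= 4)%Z by [].
    have := at_p 1%Z p1; rewrite -(at_p 0%Z p0) => -[h1 h2].
    by case: (c) h1 h2 => ? ? /= ? ?; congr pair; lia.
  (* Both edges lie on the line through their common point [o] with direction [d], which contains at
     most one edge. *)
  apply: (line_edges _ (is_line_direction R o d0)) => // _ [y ey <-].
    rewrite -(of_intK y) in ey *; apply: direction_lineP.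
    by apply: progression_parallel; [exact/e_eq|exact/e_eq|rewrite /cross; lia].
  rewrite -(of_intK y) in ey *; apply: direction_lineP.
  by apply: progression_parallel; [exact/f_eq|exact/f_eq|].
(* A covering must consist of vertices, so the other points found are discarded; a point on an edge
   is a vertex and survives. *)
apply: (covering_number_le (C := [set` map to_int C] `&` vertices H)).
  split=> [x []//|e He]; have [//|p pC ep] := Ccov (trace e); first by exists e.
  exists (to_int p); split=> //; split; last exact: edges_sub He _ ep.
  exact: map_f.
apply: card_le_trans (subset_card_le (@subIsetl _ _ _)) _.
apply: card_le_trans (card_seq_le _) _.
by rewrite card_le_II size_map.
Qed.
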